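(* Let $k,r\ge 1$ be integers. Then, as an identity of rational functions in $x$, $$F_{k,r}(x) = (-1)^{kr}\, x^{-r(r-1+2k)/2}\, F_{k,r}\!\left(\frac 1x\right).$$
   Context: For integers $k,r\ge 1$ and $n\ge 0$, let $\alpha_{k,r}(n)$ be the number of $k\times r$ matrices $(m_{i,j})$ of non-negative integers such that $m_{i,j}\ge m_{i+1,j}$ for $1\le i<k$, $m_{i,j}\ge m_{i,j+1}$ for $1\le j<r$ (all rows and columns weakly decreasing), and $m_{1,1}+\dots+m_{1,r}=n$. Let $F_{k,r}(x)=\sum_{n=0}^\infty \alpha_{k,r}(n)x^n$ be the generating function. This power series is the expansion at $0$ of a rational function, also denoted $F_{k,r}$, and $F_{k,r}(1/x)$ means substitution of $1/x$ into this rational function. *)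

(* Defs.v *)
From HB Require Import structures.
From mathcomp Require Import all_boot all_order all_algebra.

Set Implicit Arguments.
Unset Strict Implicit.
Unset Printing Implicit Defensive.

Import GRing.Theory.
Local Open Scope ring_scope.
Local Open Scope quotient_scope.

Definition decreasing_rows_cols (k r : nat) (m : 'M[nat]_(k, r)) : bool :=
  [forall i : 'I_k, forall i' : 'I_k, forall j : 'I_r,
     (i' == i.+1 :> nat) ==> (m i' j <= m i j)%N] &&
  [forall i : 'I_k, forall j : 'I_r, forall j' : 'I_r,
     (j' == j.+1 :> nat) ==> (m i j' <= m i j)%N].

(* Indices start at 0, so the first row is the one of index 0. *)
Definition first_row_sum (k r : nat) (m : 'M[nat]_(k, r)) : nat :=
  (\sum_(i < k | i == 0 :> nat) \sum_(j < r) m i j)%N.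

Definition admissible (k r n : nat) (m : 'M[nat]_(k, r)) : bool :=
  decreasing_rows_cols m && (first_row_sum m == n).

(* The entries of an admissible matrix are at most n, so it is enough to range *)
(* over the finite type of matrices with entries in {0,...,n}; [alphaP] below  *)
(* shows that no matrix over nat is lost.                                      *)
Definition alpha (k r n : nat) : nat :=
  #|[set m : 'M['I_n.+1]_(k, r) | admissible n (map_mx (@nat_of_ord n.+1) m)]|.

Lemma admissible_le (k r n : nat) (m : 'M[nat]_(k, r)) (i : 'I_k) (j : 'I_r) :
  admissible n m -> (m i j <= n)%N.
Proof.
case/andP=> /andP[/forallP Hr _] /eqP <-.
case: i => i ltik; elim: i ltik => [|i IHi] ltik.
  rewrite /first_row_sum (bigD1 (Ordinal ltik)) //= (bigD1 j) //= -addnA.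
  exact: leq_addr.
apply: leq_trans (IHi (ltnW ltik)).
have /forallP/(_ (Ordinal ltik))/forallP/(_ j) := Hr (Ordinal (ltnW ltik)).
by rewrite /= eqxx.
Qed.

Lemma alphaP (k r n : nat) :
  exists s : seq 'M[nat]_(k, r),
    [/\ uniq s, size s = alpha k r n & forall m, (m \in s) = admissible n m].
Proof.
pose A := [set m : 'M['I_n.+1]_(k, r)
            | admissible n (map_mx (@nat_of_ord n.+1) m)].
exists [seq map_mx (@nat_of_ord n.+1) m | m : 'M['I_n.+1]_(k, r) <- enum A].
split.
- rewrite map_inj_uniq ?enum_uniq // => m1 m2 /matrixP E.
  by apply/matrixP=> i j; apply: val_inj; have := E i j; rewrite !mxE.
- by rewrite size_map -cardE.
- move=> m; apply/mapP/idP => [[m' + ->]|adm]; first by rewrite mem_enum inE.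
  have E : m = map_mx (@nat_of_ord n.+1) (\matrix_(i, j) inord (m i j)).
    by apply/matrixP=> i j; rewrite !mxE inordK // ltnS admissible_le.
  by exists (\matrix_(i, j) inord (m i j)); rewrite // mem_enum inE -E.
Qed.

Local Notation "x %:F" := (@FracField.tofrac _ x).

Notation ratfun := {fraction {poly rat}}.

Definition ratfun_cst (c : rat) : ratfun := (c%:P)%:F.

Definition ratfun_X : ratfun := ('X : {poly rat})%:F.

Definition poly_at (p : {poly rat}) (g : ratfun) : ratfun :=
  (map_poly ratfun_cst p).[g].

(* Substitution of g in f, computed on a representative of f; it is            *)
(* meaningful when the denominator does not vanish at g, e.g. for g = 1/x      *)
(* (see [ratfun_subst_invX]).                                                  *)
Definition ratfun_subst (f g : ratfun) : ratfun :=
  poly_at \n_(repr f) g / poly_at \d_(repr f) g.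

(* f = p/q is regular at 0 and q * (\sum_n a_n x^n) = p as formal power series *)
Definition expansion_at0 (f : ratfun) (a : nat -> rat) : Prop :=
  exists p q : {poly rat},
    [/\ q`_0 != 0, f = p%:F / q%:F
      & forall n : nat, \sum_(i < n.+1) q`_i * a (n - i)%N = p`_n].

HB.instance Definition _ :=
  GRing.RMorphism.copy ratfun_cst ((@FracField.tofrac _) \o (@polyC rat)).

Lemma poly_atM p q g : poly_at (p * q) g = poly_at p g * poly_at q g.
Proof. by rewrite /poly_at rmorphM hornerM. Qed.

Lemma poly_at_X p : poly_at p ratfun_X = p%:F.
Proof.
rewrite /poly_at horner_coef size_map_poly -[in RHS](coefK p) poly_def rmorph_sum.
by apply: eq_bigr => i _; rewrite coef_map -mul_polyC rmorphM rmorphXn.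
Qed.

Lemma ratfun_X_neq0 : ratfun_X != 0.
Proof. by rewrite tofrac_eq0 polyX_eq0. Qed.

Lemma poly_at_invX_neq0 q : q != 0 -> poly_at q ratfun_X^-1 != 0.
Proof.
move=> q0; have q'0 : map_poly ratfun_cst q != 0 by rewrite map_poly_eq0.
pose rv := \poly_(i < size q) q`_((size q).-1 - i).
have sq : (0 < size q)%N by rewrite size_poly_gt0.
have rv0 : rv != 0.
  apply/eqP=> /(congr1 (fun p : {poly rat} => p`_0)).
  by rewrite coef0 coef_poly sq subn0; apply/eqP; rewrite -lead_coefE lead_coef_eq0.
have : rv%:F != 0 by rewrite tofrac_eq0.
apply: contra => /eqP E; apply/eqP.
have -> : rv%:F = ratfun_X ^+ (size q).-1 * poly_at q ratfun_X^-1.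
  rewrite /poly_at horner_coef size_map_poly mulr_sumr /rv poly_def rmorph_sum.
  rewrite (reindex_inj rev_ord_inj) /=; apply: eq_bigr => i _.
  rewrite coef_map -mul_polyC rmorphM rmorphXn /= -[RHS]mulrCA; congr (_ * _).
    by congr (ratfun_cst q`_ _); case: (size q) i sq => [|s] i //= _;
       rewrite subSS subKn // -ltnS.
  have lei : (i <= (size q).-1)%N by rewrite -ltnS prednK.
  rewrite -{1}(subnK lei) exprD exprVn mulfK ?expf_neq0 ?ratfun_X_neq0 //.
  by rewrite -subn1 -subnDA add1n.
by rewrite E mulr0.
Qed.

Lemma numden_pi (u : {ratio {poly rat}}) :
  (\pi_ratfun u : ratfun) * (\d_u)%:F = (\n_u)%:F.
Proof.
unlock FracField.tofrac; rewrite -[LHS]FracField.pi_mul; apply/eqmodP.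
rewrite /= FracField.equivfE /FracField.mulf.
by rewrite !numden_Ratio ?mulf_neq0 ?oner_eq0 ?denom_ratioP // !mulr1 mulrC.
Qed.

Lemma ratfun_subst_invX (p q : {poly rat}) : q != 0 ->
  ratfun_subst (p%:F / q%:F) ratfun_X^-1 =
  poly_at p ratfun_X^-1 / poly_at q ratfun_X^-1.
Proof.
move=> q0; rewrite /ratfun_subst.
have fq : p%:F / q%:F * q%:F = p%:F by rewrite divfK ?tofrac_eq0.
move: (p%:F / q%:F) fq => f fq.
have d0 : \d_(repr f) != 0 by exact: denom_ratioP.
have E : \n_(repr f) * q = p * \d_(repr f).
  by apply/eqP; rewrite -tofrac_eq !tofracM -numden_pi reprK mulrAC fq.
by apply/eqP; rewrite eqr_div ?poly_at_invX_neq0 // -!poly_atM E.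
Qed.

Lemma expansion_at0_inj (f g : ratfun) (a : nat -> rat) :
  expansion_at0 f a -> expansion_at0 g a -> f = g.
Proof.
move=> [p [q [q0 -> Hp]]] [p' [q' [q'0 -> Hp']]].
have nz (u : {poly rat}) : u`_0 != 0 -> u%:F != 0.
  by rewrite tofrac_eq0; apply: contra => /eqP ->; rewrite coef0.
apply/eqP; rewrite eqr_div ?nz // -!tofracM tofrac_eq; apply/eqP/polyP=> n.
pose A := \poly_(i < n.+1) a i.
have trunc (u v : {poly rat}) :
    (forall m, \sum_(i < m.+1) u`_i * a (m - i)%N = v`_m) ->
    forall m, (m <= n)%N -> (u * A)`_m = v`_m.
  move=> H m lemn; rewrite coefM -H; apply: eq_bigr => i _.
  by rewrite coef_poly ltnS (leq_trans (leq_subr _ _) lemn).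
have -> : (p * q')`_n = (q * A * q')`_n.
  rewrite !coefM; apply: eq_bigr => i _.
  by rewrite (trunc _ _ Hp) // -ltnS.
have -> : (p' * q)`_n = (q' * A * q)`_n.
  rewrite !coefM; apply: eq_bigr => i _.
  by rewrite (trunc _ _ Hp') // -ltnS.
by rewrite [LHS](congr1 (fun u : {poly rat} => u`_n) (mulrC _ _)) [q * A]mulrC mulrA.
Qed.

(* Main.v *)
(* Let P be the k x r grid, ordered so that the cell (0,0) is on top, and weigh
   a cell by 1 if it lies in the first row and by 0 otherwise. For an order
   ideal I of P (closed upwards towards (0,0)) of weight w(I), let G_I count
   the decreasing maps P -> nat supported in I, and H_I those with support I
   that are strictly decreasing on I. Removing the bottom layer of such a map
   gives
     G_I = sum_(J ideal in I) x^w(J) G_J,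
     H_I = x^w(I) sum_(J ideal in I, I \ J antichain) H_J,
   which determine rational functions, as w(I) > 0 for nonempty I. A
   sign-reversing involution (the Moebius function of the lattice of ideals)
   shows that (-1)^|I| H_I(x) satisfies the recursion of G_I(1/x), hence equals
   it. Finally P is graded, so subtracting the rank turns strictly decreasing
   positive maps into decreasing ones: H_P = x^N G_P, where
   N = r (r - 1 + 2 k) / 2 is the sum of the ranks over the first row. *)
Require Import Defs.
From mathcomp Require Import all_boot all_order all_algebra.

Set Implicit Arguments.
Unset Strict Implicit.
Unset Printing Implicit Defensive.

Import GRing.Theory.
Local Open Scope ring_scope.

Local Notation "x %:F" := (@FracField.tofrac _ x).

(** * Expansions at 0: sums, shifts and division by 1 - x^d *)

Definition shift (d : nat) (a : nat -> rat) (n : nat) : rat :=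
  if (d <= n)%N then a (n - d)%N else 0.

(** A series enters its n-th convolution only through its first coefficients, so a polynomial
    truncation may replace it and the ring laws of polynomials apply. *)
Lemma conv_coef (q A : {poly rat}) (a : nat -> rat) (n : nat) :
  (forall i, (i <= n)%N -> A`_i = a i) ->
  \sum_(i < n.+1) q`_i * a (n - i)%N = (q * A)`_n.
Proof.
by move=> AE; rewrite coefM; apply: eq_bigr => i _; rewrite AE ?leq_subr.
Qed.

Lemma tofracXn (d : nat) : ('X^d)%:F = ratfun_X ^+ d :> ratfun.
Proof. exact: rmorphXn. Qed.

Lemma eq_expansion_at0 (F : ratfun) (a b : nat -> rat) :
  a =1 b -> expansion_at0 F a -> expansion_at0 F b.
Proof.
move=> ab [p [q [q0 -> H]]]; exists p, q; split=> // n.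
by rewrite -H; apply: eq_bigr => i _; rewrite ab.
Qed.

Lemma expansion_at0_0 : expansion_at0 0 (fun=> 0).
Proof.
exists 0, 1; split; rewrite ?tofrac0 ?mul0r //; first by rewrite coef1 oner_neq0.
by move=> n; rewrite coef0 big1 // => i _; rewrite mulr0.
Qed.

Lemma expansion_at0_1 : expansion_at0 1 (fun n => (n == 0)%:R).
Proof.
exists 1, 1; split; rewrite ?tofrac1 ?divr1 //; first by rewrite coef1 oner_neq0.
move=> n; rewrite -[1 in RHS]mul1r; apply: (@conv_coef _ _ (fun n => (n == 0)%:R)) => i _.
by rewrite coef1.
Qed.

Lemma expansion_at0D (F G : ratfun) (a b : nat -> rat) :
  expansion_at0 F a -> expansion_at0 G b ->
  expansion_at0 (F + G) (fun n => a n + b n).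
Proof.
have nz (u : {poly rat}) : u`_0 != 0 -> u%:F != 0.
  by rewrite tofrac_eq0; apply: contra => /eqP ->; rewrite coef0.
move=> [p [q [q0 -> Hp]]] [p' [q' [q'0 -> Hp']]].
exists (p * q' + p' * q), (q * q'); split.
- by rewrite coef0M mulf_neq0.
- by rewrite addf_div ?nz // -!tofracM -tofracD.
move=> n; pose A := \poly_(i < n.+1) a i; pose B := \poly_(i < n.+1) b i.
have AE m : (m <= n)%N -> forall i, (i <= m)%N -> A`_i = a i.
  by move=> mn i im; rewrite coef_poly ltnS (leq_trans im mn).
have BE m : (m <= n)%N -> forall i, (i <= m)%N -> B`_i = b i.
  by move=> mn i im; rewrite coef_poly ltnS (leq_trans im mn).
have ABE i : (i <= n)%N -> (A + B)`_i = a i + b i.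
  by move=> im; rewrite coefD (AE n) ?(BE n).
rewrite [LHS](@conv_coef _ _ (fun n => a n + b n) _ ABE) mulrDr !coefD; congr (_ + _).
  rewrite mulrAC !coefM; apply: eq_bigr => i _.
  by have im : (i <= n)%N := ltn_ord i; rewrite -Hp (conv_coef _ (AE i im)).
rewrite [q * q']mulrC mulrAC !coefM; apply: eq_bigr => i _.
by have im : (i <= n)%N := ltn_ord i; rewrite -Hp' (conv_coef _ (BE i im)).
Qed.

Lemma expansion_at0_sum (I : finType) (P : pred I) (F : I -> ratfun)
    (a : I -> nat -> rat) :
  (forall i, P i -> expansion_at0 (F i) (a i)) ->
  expansion_at0 (\sum_(i | P i) F i) (fun n => \sum_(i | P i) a i n).
Proof.
move=> H; elim: (index_enum I) => [|i s IHs].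
  rewrite big_nil; apply: eq_expansion_at0 expansion_at0_0 => n.
  by rewrite big_nil.
rewrite big_cons; case Pi: (P i).
  apply: eq_expansion_at0 (expansion_at0D (H i Pi) IHs) => n.
  by rewrite big_cons Pi.
by apply: eq_expansion_at0 IHs => n; rewrite big_cons Pi.
Qed.

Lemma expansion_at0_shift (d : nat) (F : ratfun) (a : nat -> rat) :
  expansion_at0 F a -> expansion_at0 (ratfun_X ^+ d * F) (shift d a).
Proof.
move=> [p [q [q0 -> Hp]]]; exists ('X^d * p), q; split=> //.
  by rewrite tofracM tofracXn mulrA.
move=> n; pose A := \poly_(i < n.+1) a i.
rewrite (@conv_coef _ ('X^d * A)) => [|i im]; last first.
  rewrite coefXnM /shift [(d <= i)%N]leqNgt; case: ltnP => //= di.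
  by rewrite coef_poly ltnS (leq_trans (leq_subr _ _) im).
rewrite mulrCA !coefXnM; case: ltnP => // dn.
rewrite -Hp -(@conv_coef _ A a) // => i im.
by rewrite coef_poly ltnS (leq_trans im) ?leq_subr.
Qed.

(** This solves a series equation in which the unknown also occurs shifted by d; [0 < d] keeps the
    constant coefficient of the new denominator nonzero. *)
Lemma expansion_at0_divB (d : nat) (F : ratfun) (a : nat -> rat) :
  (0 < d)%N -> expansion_at0 F (fun n => a n - shift d a n) ->
  expansion_at0 (F / (1 - ratfun_X ^+ d)) a.
Proof.
move=> d0 [p [q [q0 -> Hp]]]; exists p, (q * (1 - 'X^d)); split.
- rewrite coef0M mulf_neq0 // coefB coef1 coefXn eqxx.
  by rewrite (ltn_eqF d0) subr0 oner_neq0.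
- by rewrite tofracM tofracB tofrac1 tofracXn invfM mulrA.
move=> n; pose A := \poly_(i < n.+1) a i.
rewrite (@conv_coef _ A) => [|i im]; last by rewrite coef_poly ltnS im.
rewrite -mulrA -Hp; apply/esym.
apply: (@conv_coef _ _ (fun n => a n - shift d a n)) => i im.
rewrite mulrBl mul1r coefB coefXnM /shift [(d <= i)%N]leqNgt coef_poly ltnS im.
congr (_ - _); case: ltnP => //= di.
by rewrite coef_poly ltnS (leq_trans (leq_subr _ _) im).
Qed.

Lemma ratfun_X_exp_neq1 (d : nat) : (0 < d)%N -> ratfun_X ^+ d != 1.
Proof.
move=> d0; rewrite -tofracXn -tofrac1 tofrac_eq.
apply/eqP => /(congr1 (fun p : {poly rat} => p`_0)).
by rewrite coefXn coef1 (ltn_eqF d0).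
Qed.

(** * Substitution of 1/x respects the ring operations *)

Local Notation invX := (ratfun_subst^~ ratfun_X^-1).

Lemma ratfun_fracP (f : ratfun) : exists p q : {poly rat}, q != 0 /\ f = p%:F / q%:F.
Proof.
exists \n_(repr f), \d_(repr f); have d0 := denom_ratioP (repr f).
split=> //; rewrite -numden_pi reprK mulfK // tofrac_eq0 //.
Qed.

Lemma ratfun_subst_invX_poly (p : {poly rat}) :
  invX p%:F = poly_at p ratfun_X^-1.
Proof.
rewrite -[p%:F]divr1 -tofrac1 ratfun_subst_invX ?oner_neq0 //.
by rewrite /poly_at rmorph1 hornerC divr1.
Qed.

(** Substitution is defined on a chosen representative, and sums need not respect that choice;
    [ratfun_subst_invX] allows any fraction p/q instead. *)
Lemma ratfun_subst_invXD (f g : ratfun) : invX (f + g) = invX f + invX g.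
Proof.
have [p [q [q0 ->]]] := ratfun_fracP f; have [p' [q' [q'0 ->]]] := ratfun_fracP g.
rewrite addf_div ?tofrac_eq0 // -!tofracM -tofracD.
rewrite !ratfun_subst_invX ?mulf_neq0 // addf_div ?poly_at_invX_neq0 //.
by rewrite -!poly_atM /poly_at rmorphD hornerD.
Qed.

Lemma ratfun_subst_invXM (f g : ratfun) : invX (f * g) = invX f * invX g.
Proof.
have [p [q [q0 ->]]] := ratfun_fracP f; have [p' [q' [q'0 ->]]] := ratfun_fracP g.
rewrite mulf_div -!tofracM !ratfun_subst_invX ?mulf_neq0 //.
by rewrite mulf_div -!poly_atM.
Qed.

Lemma ratfun_subst_invX1 : invX 1 = 1.
Proof. by rewrite -tofrac1 ratfun_subst_invX_poly /poly_at rmorph1 hornerC. Qed.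

Lemma ratfun_subst_invX_sum (I : finType) (P : pred I) (F : I -> ratfun) :
  invX (\sum_(i | P i) F i) = \sum_(i | P i) invX (F i).
Proof.
apply: (big_morph (fun f => invX f)); first exact: ratfun_subst_invXD.
by rewrite -tofrac0 ratfun_subst_invX_poly /poly_at rmorph0 horner0.
Qed.

Lemma ratfun_subst_invXXn (d : nat) : invX (ratfun_X ^+ d) = ratfun_X ^- d.
Proof.
rewrite -[in LHS]tofracXn ratfun_subst_invX_poly /poly_at.
by rewrite map_polyXn hornerXn exprVn.
Qed.

(** Covers both recursions, since [d] may depend on I or on J. By induction on the size of I, the
    term J = I is moved to the left and 1 - x^(d I I) is divided out; uniqueness of expansions then
    lifts the recursion to the rational functions. *)
Lemma recursive_expansion (T : finType) (D : pred {set T}) (R : rel {set T})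
    (d : {set T} -> {set T} -> nat) (a : {set T} -> nat -> rat) :
    (forall I, D I -> R I I) ->
    (forall I J, D I -> R I J -> D J /\ J \subset I) ->
    (forall I, D I -> I != set0 -> (0 < d I I)%N) ->
    (forall n, a set0 n = (n == 0)%:R) ->
    (forall I n, D I -> a I n = \sum_(J | R I J) shift (d I J) (a J) n) ->
  exists A : {set T} -> ratfun,
    (forall I, D I -> expansion_at0 (A I) (a I)) /\
    (forall I, D I -> A I = \sum_(J | R I J) ratfun_X ^+ d I J * A J).
Proof.
move=> Rrefl Rsub d0 a0 aE.
have exA I : exists F, D I -> expansion_at0 F (a I).
  have [N] := ubnP #|I|; elim: N I => // N IHN I ltIN.
  have [DI|] := boolP (D I); last by exists 0.
  (* At the empty set the exponent may be 0 and division is impossible; there the series is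
     prescribed by [a0]. *)
  have [->|I0] := eqVneq I set0.
    by exists 1 => _; apply: eq_expansion_at0 expansion_at0_1 => n.
  have exJ J : exists F, R I J && (J != I) -> expansion_at0 F (a J).
    have [/andP[RIJ JI]|] := boolP (R I J && (J != I)); last by exists 0.
    have [DJ sJI] := Rsub I J DI RIJ.
    have [|F HF] := IHN J; last by exists F => _; apply: HF.
    by rewrite -ltnS (leq_trans _ ltIN) // ltnS proper_card // properEneq JI.
  have [F HF] := fin_all_exists exJ.
  exists ((\sum_(J | R I J && (J != I)) ratfun_X ^+ d I J * F J) /
          (1 - ratfun_X ^+ d I I)) => _.
  apply: expansion_at0_divB; first exact: d0.
  have := expansion_at0_sum (fun J RJ => expansion_at0_shift (d I J) (HF J RJ)).
  apply: eq_expansion_at0 => n.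
  by rewrite [a I n]aE // [X in _ = X - _](bigD1 I) ?Rrefl //= addrAC subrr add0r.
have [A HA] := fin_all_exists exA; exists A; split=> // I DI.
apply: expansion_at0_inj (HA I DI) _.
have HJ J : R I J -> expansion_at0 (A J) (a J).
  by move=> RIJ; apply: HA; have [] := Rsub I J DI RIJ.
have := expansion_at0_sum (fun J RJ => expansion_at0_shift (d I J) (HJ J RJ)).
by apply: eq_expansion_at0 => n; rewrite -aE.
Qed.

(** * Finite cardinalities over infinite types *)

Definition has_card (A : eqType) (P : pred A) (c : nat) : Prop :=
  exists s : seq A, [/\ uniq s, size s = c & forall x, (x \in s) = P x].

Lemma has_card_unique (A : eqType) (P : pred A) (c d : nat) :
  has_card P c -> has_card P d -> c = d.
Proof.
move=> [s [us <- sP]] [t [ut <- tP]]; apply/perm_size/uniq_perm => // x.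
by rewrite sP tP.
Qed.

Lemma has_card0 (A : eqType) (P : pred A) : (forall x, ~~ P x) -> has_card P 0.
Proof. by move=> nP; exists [::]; split=> // x; rewrite (negbTE (nP x)). Qed.

Lemma has_card1 (A : eqType) (P : pred A) (b : bool) (y : A) :
  (forall x, P x = b && (x == y)) -> has_card P b.
Proof.
by case: b => PE; [exists [:: y] | exists [::]]; split=> // x; rewrite PE ?inE.
Qed.

Lemma has_card_map (A B : eqType) (f : A -> B) (g : B -> A) (P : pred A)
    (Q : pred B) (c : nat) :
    injective f -> (forall x, P x -> Q (f x)) ->
    (forall y, Q y -> P (g y) /\ f (g y) = y) ->
  has_card P c -> has_card Q c.
Proof.
move=> injf PQ QP [s [us <- sP]]; exists (map f s).
split; rewrite ?map_inj_uniq ?size_map // => y.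
apply/mapP/idP => [[x xs ->]|Qy]; first by rewrite PQ // -sP.
by have [Pgy fgy] := QP y Qy; exists (g y); rewrite ?sP.
Qed.

Lemma has_card_partition (A : eqType) (J : finType) (f : A -> J) (P : pred A)
    (c : nat) (d : J -> nat) :
    has_card P c -> (forall j, has_card [pred x | P x && (f x == j)] (d j)) ->
  c = (\sum_j d j)%N.
Proof.
move=> [s [us <- sP]] dP; rewrite -sum1_size (partition_big f predT) //=.
apply: eq_bigr => j _; rewrite sum1_count -size_filter.
apply: has_card_unique (dP j); exists (filter (fun x => f x == j) s).
by split=> //; [exact: filter_uniq | move=> x; rewrite mem_filter sP andbC].
Qed.

(** Only maps with values up to n are enumerated; [bounded_countP] shows that none is lost when [P]
    imposes this bound. *)
Definition bounded_count (T : finType) (n : nat) (P : pred {ffun T -> nat}) : nat :=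
  count P [seq [ffun t => nat_of_ord (m t)] | m : {ffun T -> 'I_n.+1}].

Lemma bounded_countP (T : finType) (n : nat) (P : pred {ffun T -> nat}) :
  (forall m, P m -> forall t, (m t <= n)%N) -> has_card P (bounded_count n P).
Proof.
move=> leP; rewrite /bounded_count /image_mem; set s := map _ _; exists (filter P s).
split; rewrite ?size_filter //.
  rewrite filter_uniq // map_inj_uniq ?enum_uniq // => m1 m2 /ffunP E.
  by apply/ffunP => t; apply: val_inj; have := E t; rewrite !ffunE.
move=> m; rewrite mem_filter; case Pm: (P m) => //=.
apply/mapP; exists [ffun t => inord (m t)]; first by rewrite mem_enum.
by apply/ffunP => t; rewrite !ffunE inordK // ltnS leP.
Qed.

(** Translation by [b], used below with the indicator of an ideal (one layer) and with the rank
    function. *)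
Lemma has_card_add (T : finType) (b : T -> nat) (P Q : pred {ffun T -> nat}) (c : nat) :
    (forall m, P m -> Q [ffun t => m t + b t]%N) ->
    (forall m, Q m -> (forall t, b t <= m t)%N /\ P [ffun t => m t - b t]%N) ->
  has_card P c -> has_card Q c.
Proof.
move=> PQ QP; apply: (@has_card_map _ _ (fun m : {ffun T -> nat} => [ffun t => m t + b t]%N)
  (fun m : {ffun T -> nat} => [ffun t => m t - b t]%N)) => [m1 m2 /ffunP E|//|m Qm].
  by apply/ffunP => t; apply: (@addIn (b t)); have := E t; rewrite !ffunE.
have [bm Pm] := QP m Qm; split=> //.
by apply/ffunP => t; rewrite !ffunE subnK.
Qed.

(** * P-partitions and ideals of a weighted poset *)

Section PPartitions.

(** The order is given by edges: [e u v] reads as u lying directly above v. [w] is the weight, [rho]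
    the rank and [z] the top element. *)
Variables (T : finType) (e : rel T) (w rho : T -> nat) (z : T).

Lemma edgeP (Q : rel T) :
  reflect (forall u v, e u v -> Q u v) [forall u, forall v, e u v ==> Q u v].
Proof.
apply: (iffP forallP) => [H u v euv | H u].
  by have /forallP/(_ v) := H u; rewrite euv.
by apply/forallP => v; apply/implyP/H.
Qed.

Definition decreasing (m : T -> nat) : bool :=
  [forall u, forall v, e u v ==> (m v <= m u)%N].

(** Only the lower end v is tested: if I is the support, the inequality forces u into I as well. *)
Definition strictly_decreasing (I : {set T}) (m : T -> nat) : bool :=
  [forall u, forall v, e u v ==> (v \in I) ==> (m v < m u)%N].

Definition supp (m : T -> nat) : {set T} := [set t | 0 < m t]%N.

Definition ind (J : {set T}) (t : T) : nat := t \in J.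

Definition wt (m : T -> nat) : nat := (\sum_t w t * m t)%N.

Definition weakP (I : {set T}) (n : nat) (m : {ffun T -> nat}) : bool :=
  [&& decreasing m, supp m \subset I & wt m == n].

Definition strictP (I : {set T}) (n : nat) (m : {ffun T -> nat}) : bool :=
  [&& strictly_decreasing I m, supp m == I & wt m == n].

(** Phrased through the indicator so that [decreasing_le_wt] applies to ideals directly. *)
Definition ideal (J : {set T}) : bool := decreasing (ind J).

Definition weak_rel (I J : {set T}) : bool := ideal J && (J \subset I).

(* For an ideal I: J is an ideal contained in I and I :\: J is an antichain. *)
Definition strict_rel (I J : {set T}) : bool :=
  (J \subset I) && [forall u, forall v, e u v ==> (v \in I) ==> (u \in J)].

Lemma idealP (J : {set T}) :
  reflect (forall u v, e u v -> v \in J -> u \in J) (ideal J).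
Proof.
apply: (iffP (edgeP _)) => H u v /H; rewrite /ind.
  by case: (v \in J) (u \in J) => [] [].
by case: (v \in J) => [->|].
Qed.

Lemma strict_rel_ideal (I J : {set T}) : strict_rel I J -> ideal J.
Proof.
move=> /andP[sJI /edgeP H]; apply/idealP => u v /H + vJ.
by rewrite (subsetP sJI).
Qed.

Lemma strict_rel_refl (I : {set T}) : ideal I -> strict_rel I I.
Proof.
move=> /idealP H; apply/andP; split=> //; apply/edgeP => u v euv.
by apply/implyP; apply: H.
Qed.

Lemma ideal0 : ideal set0.
Proof. by apply/idealP => u v _; rewrite inE. Qed.

Lemma idealT : ideal setT.
Proof. by apply/idealP => u v _; rewrite inE. Qed.

Lemma eq_wt (m m' : T -> nat) : m =1 m' -> wt m = wt m'.
Proof. by move=> E; apply: eq_bigr => t _; rewrite E. Qed.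

Lemma wtD (m b : T -> nat) : wt (fun t => m t + b t)%N = (wt m + wt b)%N.
Proof. by rewrite -big_split; apply: eq_bigr => t _; rewrite mulnDr. Qed.

Lemma wt_subK (m b : T -> nat) :
  (forall t, b t <= m t)%N -> (wt (fun t => m t - b t) + wt b = wt m)%N.
Proof. by move=> bm; rewrite -wtD; apply: eq_wt => t; rewrite subnK. Qed.

Lemma strictP_decreasing (I : {set T}) (n : nat) (m : {ffun T -> nat}) :
  strictP I n m -> decreasing m.
Proof.
move=> /and3P[/edgeP H /eqP sI _]; apply/edgeP => u v /H.
by rewrite -sI inE; case: (m v) => //= k /ltnW.
Qed.

Hypothesis z_top : forall t, connect e z t.
Hypothesis w_z : (0 < w z)%N.

(** Values decrease along a path from [z], and the value at [z] enters the weight with a positive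
    factor. This makes the counts of given weight finite. *)
Lemma decreasing_le_wt (m : T -> nat) (t : T) : decreasing m -> (m t <= wt m)%N.
Proof.
move=> /edgeP dm; apply: (@leq_trans (m z)).
  have /connectP[p + ->] := z_top t.
  elim: p (z) => //= u p IHp y /andP[eyu /IHp H].
  exact: leq_trans H (dm _ _ eyu).
rewrite /wt (bigD1 z) //=; apply: leq_trans (leq_addr _ _).
by rewrite leq_pmull.
Qed.

Lemma wt_ideal_gt0 (J : {set T}) : ideal J -> J != set0 -> (0 < wt (ind J))%N.
Proof.
move=> iJ /set0Pn[t tJ]; apply: leq_trans (decreasing_le_wt t iJ).
by rewrite /ind tJ.
Qed.

(** * Counting functions and their recursions by layers *)

Definition weak_count (I : {set T}) (n : nat) : nat := bounded_count n (weakP I n).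

Definition strict_count (I : {set T}) (n : nat) : nat := bounded_count n (strictP I n).

Lemma weak_countP (I : {set T}) (n : nat) : has_card (weakP I n) (weak_count I n).
Proof.
apply: bounded_countP => m /and3P[dm _ /eqP <-] t.
exact: decreasing_le_wt.
Qed.

Lemma strict_countP (I : {set T}) (n : nat) : has_card (strictP I n) (strict_count I n).
Proof.
apply: bounded_countP => m sm t; have /and3P[_ _ /eqP <-] := sm.
exact: decreasing_le_wt (strictP_decreasing sm).
Qed.

Lemma weak_count_rec (I : {set T}) (n : nat) :
  weak_count I n = (\sum_(J | weak_rel I J)
    if wt (ind J) <= n then weak_count J (n - wt (ind J)) else 0)%N.
Proof.
rewrite big_mkcond /=.
(* Maps are sorted by their support J; lowering the values on J by one leaves an arbitrary
   decreasing map supported in J. *)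
pose f (m : {ffun T -> nat}) := supp m.
apply: (has_card_partition (f := f) (weak_countP I n)) => J.
case: ifPn => [/andP[/idealP iJ sJI]|nR]; last first.
  apply: has_card0 => m; apply: contra nR => /andP[/and3P[/edgeP dm sm _] /eqP <-].
  apply/andP; split=> //; apply/idealP => u v /dm; rewrite !inE => vu v0.
  exact: leq_trans v0 vu.
(* The default 0 is correct: a map with support J is at least 1 on J, so its weight is at least that
   of J. *)
case: leqP => [leJn|ltnJ]; last first.
  apply: has_card0 => m; apply/negP => /andP[/and3P[_ _ /eqP E] /eqP sJ].
  move: ltnJ; rewrite ltnNge -E; case/negP; apply: leq_sum => t _.
  by apply: leq_mul => //; rewrite /ind -sJ inE; case: (m t).
apply: (has_card_add (b := ind J)) (weak_countP J _) => m.
  move=> /and3P[/edgeP dm /subsetP sm /eqP E].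
  have mJ t : t \notin J -> m t = 0%N.
    by apply: contraNeq => mt; apply: sm; rewrite inE lt0n.
  have sJ : supp [ffun t => m t + ind J t]%N = J.
    apply/setP => t; rewrite inE ffunE /ind.
    by case: (boolP (t \in J)) => [|/mJ ->]; rewrite ?addn1.
  rewrite /= /f sJ eqxx andbT; apply/and3P; split.
  - apply/edgeP => u v euv; rewrite !ffunE leq_add ?dm // /ind.
    by case vJ: (v \in J) => //; rewrite (iJ u v).
  - by rewrite sJ.
  by rewrite (eq_wt (ffunE _)) wtD E subnK.
move=> /andP[/and3P[/edgeP dm sm /eqP E] /eqP sJ].
have bm t : (ind J t <= m t)%N by rewrite /ind -sJ inE; case: (m t).
split=> //; apply/and3P; split.
- apply/edgeP => u v euv; rewrite !ffunE /ind -sJ !inE.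
  by have := dm u v euv; case: (m v) (m u) => [|x] [|y] //=; rewrite !subn1.
- apply/subsetP => t; rewrite inE ffunE => mt.
  by rewrite -sJ inE; apply: leq_trans mt (leq_subr _ _).
by rewrite (eq_wt (ffunE _)) -E -(wt_subK bm) addnK.
Qed.

(** The layer removed is now the indicator of I itself, and J, where the value exceeds 1, is the
    support of the rest. On the remainder of I the value is exactly 1, so strictness makes it an
    antichain. *)
Lemma strict_count_rec (I : {set T}) (n : nat) :
  strict_count I n = (\sum_(J | strict_rel I J)
    if wt (ind I) <= n then strict_count J (n - wt (ind I)) else 0)%N.
Proof.
rewrite big_mkcond /=.
pose f (m : {ffun T -> nat}) := [set t | 1 < m t]%N.
apply: (has_card_partition (f := f) (strict_countP I n)) => J.
case: ifPn => [/andP[/subsetP sJI /edgeP RIJ]|nR]; last first.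
  apply: has_card0 => m; apply: contra nR => /andP[/and3P[/edgeP dm /eqP sI _] /eqP <-].
  apply/andP; split; first by apply/subsetP => t; rewrite -sI !inE => /ltnW.
  apply/edgeP => u v /dm /implyP H; apply/implyP => vI.
  by have := H vI; rewrite -sI !inE in vI *; apply: leq_trans.
case: leqP => [leIn|ltnI]; last first.
  apply: has_card0 => m; apply/negP => /andP[/and3P[_ /eqP sI /eqP E] _].
  move: ltnI; rewrite ltnNge -E; case/negP; apply: leq_sum => t _.
  by apply: leq_mul => //; rewrite /ind -sI inE; case: (m t).
apply: (has_card_add (b := ind I)) (strict_countP J _) => m.
  move=> /and3P[/edgeP dm /eqP/setP sJ /eqP E].
  have m_gt0 t : (0 < m t)%N = (t \in J) by rewrite -sJ inE.
  have m_out t : t \notin I -> m t = 0%N.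
    by move=> tI; apply/eqP; rewrite -leqn0 leqNgt m_gt0; apply: contra tI => /sJI.
  apply/andP; split; first (apply/and3P; split).
  - apply/edgeP => u v euv; apply/implyP => vI; rewrite !ffunE /ind vI.
    have uJ := implyP (RIJ u v euv) vI; rewrite sJI // ltn_add2r.
    have /implyP H := dm u v euv.
    (* For v in I outside J the value of [m] is 0, while the antichain condition puts u in J, where
       [m] is positive. *)
    case: (boolP (v \in J)) => // vJ; rewrite -m_gt0 lt0n negbK in vJ.
    by rewrite (eqP vJ) m_gt0.
  - apply/eqP/setP => t; rewrite inE ffunE /ind.
    by case: (boolP (t \in I)) => [_|/m_out ->]; rewrite ?addn1.
  - by rewrite (eq_wt (ffunE _)) wtD E subnK.
  apply/eqP/setP => t; rewrite inE ffunE /ind -m_gt0.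
  by case: (boolP (t \in I)) => [_|/m_out ->]; rewrite ?addn1.
move=> /andP[/and3P[/edgeP dm /eqP/setP sI /eqP E] /eqP/setP fJ].
have m_gt0 t : (0 < m t)%N = (t \in I) by rewrite -sI inE.
have m_gt1 t : (1 < m t)%N = (t \in J) by rewrite -fJ inE.
have bm t : (ind I t <= m t)%N by rewrite /ind -m_gt0; case: (m t).
have mE t : (m t - ind I t = (m t).-1)%N.
  by rewrite /ind -m_gt0; case: (m t) => // x; rewrite subn1.
split=> //; apply/and3P; split.
- apply/edgeP => u v euv; apply/implyP => vJ; rewrite !ffunE !mE.
  have := implyP (dm u v euv) (sJI v vJ); rewrite -m_gt1 in vJ.
  by case: (m v) (m u) vJ => [|x] [|y].
- by apply/eqP/setP => t; rewrite inE ffunE mE -m_gt1; case: (m t) => [|[]].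
by rewrite (eq_wt (ffunE _)) -E -(wt_subK bm) addnK.
Qed.

Lemma supp0P (m : {ffun T -> nat}) : (supp m == set0) = (m == [ffun=> 0%N]).
Proof.
apply/eqP/eqP => [/setP sm | ->]; last by apply/setP => t; rewrite !inE ffunE.
apply/ffunP => t; rewrite ffunE; apply/eqP.
by have := sm t; rewrite !inE lt0n => /negbFE.
Qed.

Lemma wt0 : wt [ffun=> 0%N] = 0%N.
Proof. by apply: big1 => t _; rewrite ffunE muln0. Qed.

Lemma weak_count0 (n : nat) : weak_count set0 n = (n == 0%N).
Proof.
apply: has_card_unique (weak_countP _ _) (has_card1 (y := [ffun=> 0%N]) _) => m.
rewrite /weakP subset0 supp0P [n == _]eq_sym; case: eqP => [->|_]; last by rewrite !andbF.
rewrite wt0 andbT /=; case: eqP => _; rewrite ?andbF ?andbT //.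
by apply/edgeP => u v _; rewrite !ffunE.
Qed.

Lemma strict_count0 (n : nat) : strict_count set0 n = (n == 0%N).
Proof.
apply: has_card_unique (strict_countP _ _) (has_card1 (y := [ffun=> 0%N]) _) => m.
rewrite /strictP supp0P [n == _]eq_sym; case: eqP => [->|_]; last by rewrite !andbF.
rewrite wt0 andbT /=; case: eqP => _; rewrite ?andbF ?andbT //.
by apply/edgeP => u v _; rewrite inE.
Qed.

(** * Reciprocity between weak and strict counts *)

Hypothesis rho_edge : forall u v, e u v -> rho u = (rho v).+1.

(* Toggling an element of I :\: L of maximal rank is a sign-reversing involution. *)
Lemma alternating_sum_eq0 (I L : {set T}) :
  ideal I -> L \proper I ->
  \sum_(J | weak_rel I J && strict_rel J L) (-1) ^+ #|J| = 0 :> int.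
Proof.
move=> /idealP iI /properP[sLI [t0 t0I t0L]].
have [|t /setDP[tI tL] tmax] := @arg_maxnP _ t0 (mem (I :\: L)) rho.
  exact/setDP.
(* An element directly above t is in the ideal I and has larger rank, so maximality leaves it no
   place but L. *)
have above_t u : e u t -> u \in L.
  move=> eut; apply: contraT => uL; have /tmax : u \in I :\: L.
    by apply/setDP; split=> //; apply: iI tI.
  by rewrite (rho_edge eut) /= ltnn.
pose f (J : {set T}) := if t \in J then J :\ t else t |: J.
have fK : involutive f.
  move=> J; rewrite /f; case: (boolP (t \in J)) => tJ.
    by rewrite setD11 setD1K.
  by rewrite setU11 setU1K.
have in_f J x : (x \in f J) = (x == t) (+) (x \in J).
  by rewrite /f; case: ifP => tJ; rewrite !inE; case: eqP => // ->; rewrite tJ.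
pose P J := weak_rel I J && strict_rel J L.
have Pf J : P J -> P (f J).
  move=> /andP[/andP[/idealP iJ /subsetP sJI] /andP[/subsetP sLJ /edgeP RJL]].
  have sLf x : x \in L -> x \in f J.
    by move=> xL; rewrite in_f sLJ // addbT; apply: contraNneq tL => <-.
  (* Since L is contained in [f J], this yields both that [f J] is an ideal and that [f J] minus L
     is an antichain. *)
  have fL u v : e u v -> v \in f J -> u \in L.
    move=> euv; rewrite in_f; case: eqP => [vt _|_ vJ] /=.
      by apply: above_t; rewrite -vt.
    exact: implyP (RJL u v euv) vJ.
  apply/andP; split; apply/andP; split.
  - by apply/idealP => u v euv /(fL u v euv)/sLf.
  - by apply/subsetP => x; rewrite in_f; case: eqP => [->|_ /sJI].
  - exact/subsetP.
  by apply/edgeP => u v euv; apply/implyP; apply: fL.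
(* Reindexing by [f] flips every sign, and the integers have no 2-torsion. *)
set S := LHS; have /eqP : S = - S.
  rewrite /S {1}(reindex_inj (inv_inj fK)) -sumrN /=; apply: eq_big => J.
    apply/idP/idP => [/Pf|/Pf //]; by rewrite fK.
  move=> _; rewrite /f; case: (boolP (t \in J)) => tJ.
    by rewrite [#|J|](cardsD1 t) tJ exprS mulN1r opprK.
  by rewrite cardsU1 tJ exprS mulN1r.
by rewrite -addr_eq0 -mulr2n Num.Theory.mulrn_eq0 => /eqP.
Qed.

(** Induction on the size of I: both sides obey one recursion, which determines them because 1 -
    x^(-w(I)) is nonzero for a nonempty ideal I. *)
Lemma weak_strict_reciprocity (G H : {set T} -> ratfun) :
    G set0 = 1 -> H set0 = 1 ->
    (forall I, ideal I -> G I = \sum_(J | weak_rel I J) ratfun_X ^+ wt (ind J) * G J) ->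
    (forall I, ideal I -> H I = \sum_(J | strict_rel I J) ratfun_X ^+ wt (ind I) * H J) ->
  forall I, ideal I -> ratfun_subst (G I) ratfun_X^-1 = (-1) ^+ #|I| * H I.
Proof.
move=> G0 H0 GE HE I; have [N] := ubnP #|I|; elim: N I => // N IHN I ltIN iI.
have [->|I0] := eqVneq I set0.
  by rewrite G0 H0 cards0 ratfun_subst_invX1 mulr1.
have X_neq0 d : ratfun_X ^+ d != 0 by rewrite expf_neq0 ?ratfun_X_neq0.
(* By the recursion of [H], x^(-w(J)) H_J is the sum of H_L over [strict_rel J L]. After exchanging
   the sums, H_L has as coefficient the alternating sum over J between L and I, which vanishes
   unless L = I; then only J = I remains. *)
have HI : (-1) ^+ #|I| * H I =
    \sum_(J | weak_rel I J) ratfun_X ^- wt (ind J) * ((-1) ^+ #|J| * H J).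
  transitivity (\sum_(J | weak_rel I J) \sum_(L | strict_rel J L) (-1) ^+ #|J| * H L);
    last first.
    apply: eq_bigr => J /andP[iJ _]; rewrite (HE J iJ) -mulr_sumr.
    by rewrite -mulr_sumr mulrCA mulKf.
  rewrite (exchange_big_dep (weak_rel I)) /= => [|J L /andP[iJ sJI] RJL]; last first.
    rewrite /weak_rel (strict_rel_ideal RJL) (subset_trans _ sJI) //.
    by case/andP: RJL.
  rewrite (bigD1 I) /=; last by rewrite /weak_rel iI /=.
  rewrite (big_pred1 I) => [|J]; last first.
    apply/andP/eqP => [[/andP[_ sJI] /andP[sIJ _]]|->].
      by apply/eqP; rewrite eqEsubset sJI.
    by rewrite /weak_rel iI strict_rel_refl /=.
  rewrite big1 ?addr0 // => L /andP[/andP[iL sLI] LI].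
  have := alternating_sum_eq0 iI (_ : L \proper I).
  rewrite properEneq LI sLI => /(_ isT)/(congr1 (fun x : int => x%:~R * H L)).
  rewrite mul0r rmorph_sum mulr_suml; apply: etrans; apply: eq_bigr => J _.
  by rewrite rmorphXn rmorphN1.
have RII : weak_rel I I by rewrite /weak_rel iI /=.
have X1 : 1 - ratfun_X ^- wt (ind I) != 0.
  rewrite subr_eq0 eq_sym; have := ratfun_X_exp_neq1 (wt_ideal_gt0 iI I0).
  by apply: contraNneq => E; rewrite -[_ ^+ _]invrK E invr1.
(* Each recursion contains its own left side as the term J = I. The factor 1 - x^(-w(I)) cancels
   these, and the other terms agree by induction. *)
apply/eqP; rewrite -subr_eq0; apply/eqP/(mulfI X1); rewrite mulr0.
rewrite mulrBl mul1r {1}GE // {1}HI ratfun_subst_invX_sum !(bigD1 I RII) /=.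
rewrite ratfun_subst_invXM ratfun_subst_invXXn.
set S1 := \sum_(_ | _) _; set S2 := \sum_(_ | _) _; have -> : S1 = S2.
  apply: eq_bigr => J /andP[/andP[iJ sJI] JI].
  rewrite ratfun_subst_invXM ratfun_subst_invXXn IHN //.
  by rewrite -ltnS (leq_trans _ ltIN) // ltnS proper_card // properEneq JI.
by rewrite [- (_ + S2)]opprD addrACA subrr addr0 mulrBr subrr.
Qed.

(** * Passing from strict to weak maps by subtracting the rank *)

Hypothesis rho_min : forall t, rho t = 1%N \/ exists v, e t v.

(** Descending an edge lowers the rank by exactly one and the value by at least one, and at rank 1
    the value is positive because the support is everything. *)
Lemma strictP_rho (n : nat) (m : {ffun T -> nat}) (t : T) :
  strictP setT n m -> (rho t <= m t)%N.
Proof.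
move=> /and3P[/edgeP dm /eqP/setP sm _].
have [N] := ubnP (rho t); elim: N t => // N IHN t ltN.
have [->|[v etv]] := rho_min t; first by have := sm t; rewrite !inE.
rewrite (rho_edge etv) in ltN *; apply: leq_ltn_trans (IHN v ltN) _.
by have := dm t v etv; rewrite inE.
Qed.

(** Translation by [rho], whose unit drop along edges trades strict for weak inequalities;
    [strictP_rho] makes the subtraction exact in [nat]. *)
Lemma strict_countT (n : nat) :
  strict_count setT n = (if wt rho <= n then weak_count setT (n - wt rho) else 0)%N.
Proof.
apply: has_card_unique (strict_countP _ _) _; case: leqP => [lern|ltnr]; last first.
  apply: has_card0 => m; apply/negP => sm; have /and3P[_ _ /eqP E] := sm.
  move: ltnr; rewrite ltnNge -E; case/negP; apply: leq_sum => t _.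
  by apply: leq_mul => //; apply: strictP_rho sm.
have rho_gt0 t : (0 < rho t)%N by case: (rho_min t) => [->|[v /rho_edge ->]].
apply: (has_card_add (b := rho)) (weak_countP _ _) => m.
  move=> /and3P[/edgeP dm _ /eqP E]; apply/and3P; split.
  - apply/edgeP => u v euv; rewrite inE !ffunE (rho_edge euv) addnS ltnS.
    by rewrite leq_add2r dm.
  - by apply/eqP/setP => t; rewrite !inE ffunE addn_gt0 rho_gt0 orbT.
  by rewrite (eq_wt (ffunE _)) wtD E subnK.
move=> sm; have rm t := strictP_rho t sm; split=> //.
have /and3P[/edgeP dm _ /eqP E] := sm; apply/and3P; split.
- apply/edgeP => u v euv; rewrite !ffunE leq_subLR addnBA ?rm //.
  have := dm u v euv; rewrite inE (rho_edge euv) subnS addKn /=.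
  by case: (m u).
- by apply/subsetP => t _; rewrite inE.
by rewrite (eq_wt (ffunE _)) -E -(wt_subK rm) addnK.
Qed.

Lemma weak_count_reciprocity :
  exists F : ratfun, expansion_at0 F (fun n => (weak_count setT n)%:R) /\
    ratfun_subst F ratfun_X^-1 = (-1) ^+ #|T| * ratfun_X ^+ wt rho * F.
Proof.
pose a I n : rat := (weak_count I n)%:R; pose b I n : rat := (strict_count I n)%:R.
have [||||I n _|G [aG GE]] := @recursive_expansion _ ideal weak_rel (fun _ J => wt (ind J)) a.
- by move=> I iI; rewrite /weak_rel iI /=.
- by move=> I J _ /andP[].
- exact: wt_ideal_gt0.
- by move=> n; rewrite /a weak_count0.
- rewrite /a weak_count_rec natr_sum; apply: eq_bigr => J _.
  by rewrite /shift; case: ifP.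
have [||||I n _|H [bH HE]] := @recursive_expansion _ ideal strict_rel (fun I _ => wt (ind I)) b.
- exact: strict_rel_refl.
- by move=> I J _ RIJ; split; [apply: strict_rel_ideal RIJ | case/andP: RIJ].
- exact: wt_ideal_gt0.
- by move=> n; rewrite /b strict_count0.
- rewrite /b strict_count_rec natr_sum; apply: eq_bigr => J _.
  by rewrite /shift; case: ifP.
exists (G setT); split; first exact: aG idealT.
rewrite (weak_strict_reciprocity _ _ GE HE idealT).
- rewrite cardsT -mulrA; congr (_ * _).
  (* By [strict_countT], [H setT] and x^(wt rho) times [G setT] have the same expansion. *)
  apply: expansion_at0_inj (bH _ idealT) _.
  have := expansion_at0_shift (wt rho) (aG _ idealT).
  apply: eq_expansion_at0 => n; rewrite /b strict_countT /shift.
  by case: ifP.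
- apply: expansion_at0_inj (aG _ ideal0) _.
  by apply: eq_expansion_at0 expansion_at0_1 => n; rewrite /a weak_count0.
apply: expansion_at0_inj (bH _ ideal0) _.
by apply: eq_expansion_at0 expansion_at0_1 => n; rewrite /b strict_count0.
Qed.

End PPartitions.

(** * The grid of cells as a graded poset *)

Section Grid.

Variables (k r : nat) (hk : (1 <= k)%N) (hr : (1 <= r)%N).

Local Notation cell := ('I_k * 'I_r)%type.

Definition cell_edge (u v : cell) : bool :=
  (v.1 == u.1.+1 :> nat) && (u.2 == v.2) || (u.1 == v.1) && (v.2 == u.2.+1 :> nat).

Definition cell_weight (u : cell) : nat := u.1 == 0 :> nat.

(** The number of cells on a monotone path from u to the bottom right cell, which thus has rank
    1. *)
Definition cell_rank (u : cell) : nat := (k - u.1 + (r - u.2.+1))%N.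

Definition corner : cell := (Ordinal hk, Ordinal hr).

Lemma connect_corner (u : cell) : connect cell_edge corner u.
Proof.
(* The path runs down the first column and then along row i. *)
case: u => i j; apply: (@connect_trans _ _ (i, Ordinal hr)).
  case: i => i; elim: i => [|i IHi] ik.
    by rewrite (_ : Ordinal ik = Ordinal hk) ?connect0 //; apply: val_inj.
  apply: connect_trans (IHi (ltnW ik)) (connect1 _).
  by rewrite /cell_edge /= !eqxx.
case: j => j; elim: j => [|j IHj] jr.
  by rewrite (_ : Ordinal jr = Ordinal hr) ?connect0 //; apply: val_inj.
apply: connect_trans (IHj (ltnW jr)) (connect1 _).
by rewrite /cell_edge /= !eqxx orbT.
Qed.

Lemma cell_rank_edge (u v : cell) : cell_edge u v -> cell_rank u = (cell_rank v).+1.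
Proof.
rewrite /cell_rank => /orP[/andP[/eqP E /eqP <-] | /andP[/eqP <- /eqP E]].
  by rewrite E -addSn subnSK // -E.
by rewrite E -addnS subnSK // -E.
Qed.

Lemma cell_rank_min (u : cell) : cell_rank u = 1%N \/ exists v, cell_edge u v.
Proof.
case: u => i j; rewrite /cell_rank /cell_edge /=.
have [ik|ki] := ltnP i.+1 k.
  by right; exists (Ordinal ik, j); rewrite /= !eqxx.
have [jr|rj] := ltnP j.+1 r.
  by right; exists (i, Ordinal jr); rewrite /= !eqxx orbT.
left; move: rj; rewrite -subn_eq0 => /eqP ->; rewrite addn0; apply/eqP.
by rewrite eqn_leq leq_subLR addn1 ki subn_gt0 ltn_ord.
Qed.

Lemma wt_cell_weight (m : cell -> nat) :
  wt cell_weight m = (\sum_(j < r) m (Ordinal hk, j))%N.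
Proof.
rewrite /wt (eq_bigr (fun p => cell_weight (p.1, p.2) * m (p.1, p.2)))%N; last by case.
rewrite -(pair_bigA _ (fun i j => cell_weight (i, j) * m (i, j)))%N /=.
rewrite (bigD1 (Ordinal hk)) //= [X in (_ + X)%N]big1 ?addn0.
  by apply: eq_bigr => j _; rewrite mul1n.
move=> i i0; apply: big1 => j _; rewrite /cell_weight /=.
by case: eqP => // E; case/eqP: i0; apply: val_inj.
Qed.

(** The first row has ranks k, ..., k + r - 1, with sum r k + C(r, 2); the division by 2 is
    therefore exact. *)
Lemma wt_cell_rank : wt cell_weight cell_rank = ((r * (r - 1 + 2 * k)) %/ 2)%N.
Proof.
rewrite wt_cell_weight /cell_rank /= subn0 big_split /= sum_nat_const card_ord.
rewrite (reindex_inj rev_ord_inj) /=.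
rewrite (eq_bigr (fun j : 'I_r => nat_of_ord j)) => [|j _]; last first.
  by rewrite subnSK // subKn // ltnW.
rewrite -(big_mkord predT (fun j => j)) bin2_sum.
suff -> : (r * (r - 1 + 2 * k) = 2 * (r * k + 'C(r, 2)))%N by rewrite mulKn.
by rewrite [RHS]mulnDr mulnCA -mul_bin_diag bin1 subn1 -mulnDr addnC.
Qed.

(** Matrices are read as functions on cells: the monotonicity conditions become the edges and the
    first row sum becomes the weight. *)
Lemma alpha_weak_count (n : nat) :
  alpha k r n = weak_count cell_edge cell_weight setT n.
Proof.
apply: has_card_unique (weak_countP connect_corner _ _ _) => //.
have row0 (M : 'M[nat]_(k, r)) :
    first_row_sum M = wt cell_weight [ffun t => M t.1 t.2].
  rewrite wt_cell_weight /first_row_sum (big_pred1 (Ordinal hk)) => [|i].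
    by apply: eq_bigr => j _; rewrite ffunE.
  by apply/eqP/eqP => [E|-> //]; apply: val_inj.
have decr (M : 'M[nat]_(k, r)) :
    decreasing_rows_cols M = decreasing cell_edge [ffun t => M t.1 t.2].
  apply/andP/edgeP => [[/forallP rM /forallP cM] [i j] [i' j']|H].
    rewrite !ffunE => /orP[/andP[/= E /eqP <-]|/andP[/= /eqP <- E]].
      by have /forallP/(_ i')/forallP/(_ j)/implyP := rM i; apply.
    by have /forallP/(_ j)/forallP/(_ j')/implyP := cM i; apply.
  split; apply/forallP => i; apply/forallP => x; apply/forallP => y; apply/implyP => E.
    by have := H (i, y) (x, y); rewrite !ffunE /cell_edge /= E eqxx; apply.
  by have := H (i, x) (i, y); rewrite !ffunE /cell_edge /= E eqxx orbT; apply.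
have adm (M : 'M[nat]_(k, r)) :
    admissible n M = weakP cell_edge cell_weight setT n [ffun t => M t.1 t.2].
  by rewrite /admissible /weakP subsetT row0 decr.
apply: (@has_card_map _ _ (fun M : 'M[nat]_(k, r) => [ffun t : cell => M t.1 t.2])
  (fun m : {ffun cell -> nat} => \matrix_(i, j) m (i, j)) (admissible n)).
- move=> M M' /ffunP E; apply/matrixP => i j; have := E (i, j).
  by rewrite !ffunE.
- by move=> M; rewrite adm.
- move=> m wm; have mE : [ffun t : cell => (\matrix_(i, j) m (i, j)) t.1 t.2] = m.
    by apply/ffunP => -[i j]; rewrite ffunE mxE.
  by rewrite adm mE.
by have [s [us ss sP]] := alphaP k r n; exists s.
Qed.

End Grid.

Theorem theorem1 (k r : nat) (hk : (1 <= k)%N) (hr : (1 <= r)%N) :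
  (exists F : ratfun, expansion_at0 F (fun n : nat => (alpha k r n)%:R)) /\
  (forall F : ratfun, expansion_at0 F (fun n : nat => (alpha k r n)%:R) ->
     F = (-1) ^+ (k * r) * ratfun_X ^- ((r * (r - 1 + 2 * k)) %/ 2)
         * ratfun_subst F ratfun_X^-1).
Proof.
have [G [HG GE]] := weak_count_reciprocity (connect_corner hk hr)
  (erefl : (0 < cell_weight (corner hk hr))%N) (@cell_rank_edge k r) (@cell_rank_min k r).
have alphaG : expansion_at0 G (fun n : nat => (alpha k r n)%:R).
  by apply: eq_expansion_at0 HG => n; rewrite (alpha_weak_count hk hr).
split=> [|F /expansion_at0_inj/(_ alphaG) ->]; first by exists G.
(* After the reciprocity is inserted, the powers of x cancel and the sign appears squared. *)
rewrite GE card_prod !card_ord (wt_cell_rank r hk) -!mulrA.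
rewrite [_ ^- _ * _]mulrCA mulKf ?expf_neq0 ?ratfun_X_neq0 //.
by rewrite mulrA -exprD addnn -mul2n exprM sqrrN expr1n expr1n mul1r.
Qed.
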